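(* For real $H,K>0$ let $$R_{H,K}(t,s)=\frac{1}{2^K}\left(\left(t^{2H}+s^{2H}\right)^K-|t-s|^{2HK}\right),\qquad s,t\ge 0.$$ If $(H_n,K_n)_{n=1}^\infty$ is a sequence of pairs of positive real numbers such that $R_{H_n,K_n}$ is nonnegative definite on $[0,\infty)$ for every $n$, and $$\lim_{n\to\infty}H_n=+\infty,$$ then $$\limsup_{n\to\infty}2H_nK_n\le 1.$$
   Context: A function $F:[0,\infty)\times[0,\infty)\to\mathbb{R}$ is called nonnegative definite if it is symmetric and for every $n\in\mathbb{N}$, all $t_1,\ldots,t_n\ge 0$ and all $z_1,\ldots,z_n\in\mathbb{C}$ one has $\sum_{j,k=1}^n z_j F(t_j,t_k)\overline{z_k}\ge 0$. *)

(* Defs.v *)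
From mathcomp Require Import all_boot all_order all_algebra.
From mathcomp Require Import complex.
From mathcomp Require Import all_classical all_reals all_analysis.

Set Implicit Arguments.
Unset Strict Implicit.
Unset Printing Implicit Defensive.

Import Order.TTheory GRing.Theory Num.Theory.
Import numFieldNormedType.Exports.

Local Open Scope ring_scope.
Local Open Scope complex_scope.

(* A function on [0, +oo[ x [0, +oo[ is represented by a function on R x R of
   which only the values at nonnegative arguments matter. In the order of R[i],
   [0 <= w] means that [w] is real and nonnegative. *)
Definition nonnegative_definite (R : realType) (F : R -> R -> R) : Prop :=
  (forall s t : R, 0 <= s -> 0 <= t -> F s t = F t s) /\
  (forall (n : nat) (t : 'I_n -> R) (z : 'I_n -> R[i]),
     (forall j, 0 <= t j) ->
     0 <= \sum_(j < n) \sum_(k < n) z j * (F (t j) (t k))%:C * (z k)^*).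

(* The exponents are positive in every use, so that the convention
   [0 `^ a = 0] for [a != 0] gives the usual value of the powers at [0]. *)
Definition RHK (R : realType) (H K : R) (t s : R) : R :=
  1 / (2 `^ K) *
    ((t `^ (2 * H) + s `^ (2 * H)) `^ K - `|t - s| `^ (2 * H * K)).

(* Main.v *)
Require Import Defs.
From mathcomp Require Import all_boot all_order all_algebra.
From mathcomp Require Import complex ring lra.
From mathcomp Require Import all_classical all_reals all_analysis.

Import Order.TTheory GRing.Theory Num.Theory.
Import numFieldNormedType.Exports.

Local Open Scope classical_set_scope.
Local Open Scope ring_scope.

(** The argument only uses the Gram inequality [F s t ^+ 2 <= F s s * F t t] at
    the two points [1] and [1 - x].  Write [a = 2 * H * K].  Since
    [1 + (1 - x) `^ (2 * H) >= 1], it yields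
    [1 <= x `^ a + 2 `^ K * (1 - x) `^ (H * K)]
    for every [x] in the open unit interval ([RHK_Gram_bound]).

    When [H] is large at fixed [a], the factor [2 `^ K = 2 `^ (a / (2 * H))]
    is close to [1], so the right-hand side is close to
    [x `^ a + (1 - x) `^ (a / 2)].  For [a > 1] and small [x] this is about
    [1 - a * x / 2 + x `^ a], hence less than [1].  The delicate point is to
    choose one [x] for all [a >= 1 + e], with no upper bound on [a].  Rewriting
    [2 `^ K * (1 - x) `^ (H * K)] as [(2 `^ H^-1 * (1 - x)) `^ (a / 2)] shows
    that, once [2 `^ H^-1 * (1 - x) <= (1 - x / 2) ^+ 2], it is at most
    [(1 - x / 2) `^ a <= 1 - x / 2]; and [x `^ a <= x `^ (1 + e) = x / 4] for
    [x = 4^-1 `^ e^-1].  The total, [1 - x / 4], contradicts the bound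
    ([RHK_nonnegative_definite_exponent_lt]). *)

(** Evaluating the form on real vectors [(a, b)] gives a nonnegative binary
    quadratic form, whose discriminant is therefore nonpositive. *)
Lemma nonnegative_definite_Gram {R : realType} (F : R -> R -> R) (s t : R) :
  nonnegative_definite F -> 0 <= s -> 0 <= t ->
  F s t ^+ 2 <= F s s * F t t.
Proof.
move=> [symF posF] s0 t0.
have conjR (r : R) :
    Num.conj (r%:C)%C = (r%:C)%C by exact: conjc_real.
have form_ge0 (a b : R) :
    0 <= a ^+ 2 * F s s + 2 * (a * b * F s t) + b ^+ 2 * F t t.
  have := posF 2 (fun j => if j == ord0 then s else t)
    (fun j => ((if j == ord0 then a else b)%:C)%C).
  rewrite !big_ord_recl !big_ord0 /= !conjR -!rmorphM !addr0 -!rmorphD /=.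
  rewrite (symF t s) // => /(_ _); rewrite lecR => H.
  have {}H := H (fun j => match j == ord0 as c return 0 <= (if c then s else t)
    with true => s0 | false => t0 end).
  by apply: le_trans H _; rewrite le_eqVlt; apply/orP; left; apply/eqP; ring.
have Fss0 : 0 <= F s s by have := form_ge0 1 0; lra.
have [Fss_gt0|Fss_le0] := ltP 0 (F s s).
  (* The minimiser of the form over [a] at [b = - F s s]. *)
  have := form_ge0 (F s t) (- F s s).
  have -> : F s t ^+ 2 * F s s + 2 * (F s t * - F s s * F s t)
            + (- F s s) ^+ 2 * F t t
          = F s s * (F s s * F t t - F s t ^+ 2) by ring.
  by rewrite pmulr_rge0 // subr_ge0.
have Fss_eq0 : F s s = 0 by apply/eqP; rewrite eq_le Fss_le0.
have Ftt0 : 0 <= F t t by have := form_ge0 0 1; lra.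
(* The form is now affine in [a]: a vector far along the first axis forces
   [F s t] to vanish. *)
have := form_ge0 (- (F t t + 1)) (F s t); rewrite Fss_eq0; nra.
Qed.

Lemma RHK_diag {R : realType} (H K s : R) : 0 < H -> 0 < K -> 0 <= s ->
  RHK H K s s = s `^ (2 * H * K).
Proof.
move=> H0 K0 s0; rewrite /RHK subrr normr0 powR0 ?subr0; last first.
  by rewrite gt_eqF // !mulr_gt0.
have -> : s `^ (2 * H) + s `^ (2 * H) = 2 * s `^ (2 * H) by ring.
by rewrite powRM ?powR_ge0 // -powRrM mulrA mul1r mulVf ?mul1r // gt_eqF // powR_gt0.
Qed.

(** The Gram inequality at the points [1] and [1 - x], after taking square roots:
    both sides are squares of nonnegative numbers. *)
Lemma RHK_Gram_bound {R : realType} (H K x : R) :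
  0 < H -> 0 < K -> nonnegative_definite (RHK H K) -> 0 < x < 1 ->
  1 <= x `^ (2 * H * K) + 2 `^ K * (1 - x) `^ (H * K).
Proof.
move=> H0 K0 ndR /andP[x0 x1].
have u0 : 0 <= 1 - x by lra.
have dist_x : `|1 - (1 - x)| = x by rewrite opprB addrC subrK gtr0_norm.
(* Dropping [(1 - x) `^ (2 * H)] costs little: it is tiny for large [H]. *)
have sum_ge1 : 1 <= (1 + (1 - x) `^ (2 * H)) `^ K.
  rewrite -[X in X <= _](powRr0 (1 + (1 - x) `^ (2 * H))).
  by rewrite ler_powR ?lerDl ?powR_ge0 ?(ltW K0).
have p2 : 0 < 2 `^ K :> R by rewrite powR_gt0.
have := @nonnegative_definite_Gram R (RHK H K) 1 (1 - x) ndR ler01 u0.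
rewrite !RHK_diag // powR1 mul1r.
have -> : (1 - x) `^ (2 * H * K) = ((1 - x) `^ (H * K)) ^+ 2.
  by rewrite -powR_mulrn ?powR_ge0 // -powRrM; congr (_ `^ _); ring.
rewrite ler_sqr ?nnegrE ?powR_ge0 //; last first.
  rewrite /RHK powR1 dist_x mulr_ge0 ?divr_ge0 ?powR_ge0 // subr_ge0.
  apply: le_trans sum_ge1; rewrite -[X in _ <= X](powRr0 x).
  by rewrite ger_powR ?x0 ?(ltW x1) // ltW // !mulr_gt0.
by rewrite /RHK powR1 dist_x div1r ler_pdivrMl // lerBlDl; apply: le_trans.
Qed.

(** The threshold on [H] depends on [e] alone, not on [K], so that it applies
    along a sequence whose exponents [2 * H * K] may be unbounded. *)
Lemma RHK_nonnegative_definite_exponent_lt {R : realType} (e : R) : 0 < e ->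
  exists H0 : R, forall H K : R, 0 < H -> 0 < K -> H0 <= H ->
    nonnegative_definite (RHK H K) -> 2 * H * K < 1 + e.
Proof.
move=> e0.
pose x : R := 4^-1 `^ e^-1.
have x0 : 0 < x by rewrite powR_gt0.
have x1 : x < 1.
  have := @gt0_ltr_powR R e^-1 _ 4^-1 1; rewrite powR1 !nnegrE.
  by apply; rewrite ?invr_gt0 //; lra.
have xe : x `^ (1 + e) = x / 4.
  rewrite powRD ?(gt_eqF x0) ?implybT // powRr1 ?(ltW x0) //; congr (_ * _).
  by rewrite -powRrM mulVf ?gt_eqF // powRr1 // invr_ge0.
(* [c] bounds [2 `^ H^-1]; it exceeds [1] because of the term [x ^+ 2 / 4] in
   the square, and [2 <= c `^ H] holds as soon as [ln 2 / ln c <= H]. *)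
pose c : R := (1 - x / 2) ^+ 2 / (1 - x).
have u0 : 0 < 1 - x by lra.
have c1 : 1 < c by rewrite /c ltr_pdivlMr // mul1r; nra.
exists (ln 2 / ln c) => H K H0 K0 leH ndR.
rewrite ltNge; apply/negP => le_a.
set a := 2 * H * K in le_a.
have HK0 : 0 <= H * K by rewrite mulr_ge0 // ltW.
have le2c : 2 <= c `^ H.
  rewrite /powR gt_eqF; last by lra.
  by rewrite -[X in X <= _](@lnK R) ?posrE // ler_expR -ler_pdivrMr // ln_gt0.
have le_x : x `^ a <= x / 4.
  by rewrite -xe ger_powR // x0 ltW.
have le_u : 2 `^ K * (1 - x) `^ (H * K) <= 1 - x / 2.
  apply: (@le_trans _ _ ((c * (1 - x)) `^ (H * K))).
    rewrite (@powRM _ c) ?(ltW u0) //; last by lra.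
    rewrite ler_wpM2r ?powR_ge0 // powRrM.
    by rewrite ge0_ler_powR ?nnegrE ?powR_ge0 ?(ltW K0).
  rewrite /c divfK ?gt_eqF // -powR_mulrn; last by lra.
  rewrite -powRrM mulrA -/a ge1r_powR //; last by lra.
  by apply/andP; split; lra.
have := @RHK_Gram_bound R H K x H0 K0 ndR; rewrite x0 x1 => /(_ isT).
rewrite -/a; lra.
Qed.

Lemma limn_esup_le_near {R : realType} (u : nat -> \bar R) (l : \bar R) :
  (\forall n \near \oo, (u n <= l)%E) -> (limn_esup u <= l)%E.
Proof.
move=> ul; apply: ereal_inf_le.
exists (ereal_sup [set u n | n in [set n | (u n <= l)%E]]).
  by exists [set n | (u n <= l)%E].
by apply: ge_ereal_sup => _ [n un <-].
Qed.

Theorem proposition1p4 (R : realType) (H K : nat -> R)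
    (H_gt0 : forall n, 0 < H n) (K_gt0 : forall n, 0 < K n)
    (RHK_nd : forall n, nonnegative_definite (RHK (H n) (K n)))
    (H_cvg : H n @[n --> \oo] --> +oo) :
  (limn_esup (fun n => (2 * H n * K n)%:E) <= 1%:E)%E.
Proof.
apply/lee_addgt0Pr => e e0.
have [H0 lt_exponent] := RHK_nonnegative_definite_exponent_lt e e0.
apply: limn_esup_le_near.
have /cvgryPge/(_ H0) := H_cvg; apply: filterS => n leH.
by rewrite -EFinD lee_fin ltW // lt_exponent.
Qed.
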